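(* Given oriented $p$-dimensional subspaces $V,W\subset X$, $$\cos\mathbf{\Theta}_{V,W}=\sum_{\mathbf{i}\in\mathcal{I}_p^n}\cos\mathbf{\Theta}_{V,X_{\mathbf{i}}}\cos\mathbf{\Theta}_{X_{\mathbf{i}},W},$$ where the $X_{\mathbf{i}}$'s are the coordinate $p$-subspaces of an orthogonal basis of $X$, with orientations given by the corresponding coordinate $p$-blades.
   Context: $X$ is an $n$-dimensional vector space over $\mathbb{R}$ (real case) or $\mathbb{C}$ (complex case) with an inner product $\langle\cdot,\cdot\rangle$ (Hermitian in the complex case, conjugate-linear in the left entry). Subspaces and dimensions are over the same field. Grassmann algebra: $\Lambda X=\bigoplus_p\Lambda^pX$ has the inner product determined by $\langle v_1\wedge\dots\wedge v_p,w_1\wedge\dots\wedge w_p\rangle=\det(\langle v_i,w_j\rangle)$ (sesquilinear in the complex case), with distinct $\Lambda^pX$'s orthogonal, and $\langle\nu,\omega\rangle=\bar\nu\omega$ for scalars $\nu,\omega\in\Lambda^0X$. An orientation of a $p$-dimensional subspace $V$ is a unit $\nu\in\Lambda^pV$, or equivalently the class $\{c\nu:c>0\}$ of a nonzero $\nu\in\Lambda^pV$ (so in the complex case there is a circle of orientations); an oriented subspace is a subspace with a choice of orientation. For $p$-dimensional oriented subspaces $V,W$ with orientations given by nonzero $\nu\in\Lambda^pV$, $\omega\in\Lambda^pW$, the (oriented) Grassmann angle $\mathbf{\Theta}_{V,W}$ is given by $\cos\mathbf{\Theta}_{V,W}=\frac{\langle\nu,\omega\rangle}{\|\nu\|\|\omega\|}$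 (with $\mathbf{\Theta}_{V,W}\in[0,\pi]$ in the real case, and $\mathbf{\Theta}_{V,W}\in\mathbb{C}$ in the complex case). For integers $1\le p\le n$, $\mathcal{I}_p^n=\{(i_1,\dots,i_p)\in\mathbb{N}^p:1\le i_1<\dots<i_p\le n\}$, and $\mathcal{I}_0^n=\{0\}$. For a basis $(w_1,\dots,w_n)$ of $X$ and $\mathbf{i}=(i_1,\dots,i_p)\in\mathcal{I}_p^n$, the coordinate $p$-subspace is $X_{\mathbf{i}}=\operatorname{span}(w_{i_1},\dots,w_{i_p})$ and the coordinate $p$-blade is $w_{i_1}\wedge\dots\wedge w_{i_p}\in\Lambda^pX_{\mathbf{i}}$; for $p=0$ they are $\{0\}$ and $1$. *)

(* Defs.v *)
From HB Require Import structures.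
From mathcomp Require Import classical_sets reals sequences trigo.
From mathcomp Require Import all_boot all_order all_algebra.
From mathcomp Require Import sesquilinear ring.
From mathcomp.real_closed Require Import complex.

Set Implicit Arguments.
Unset Strict Implicit.
Unset Printing Implicit Defensive.

Import Order.TTheory GRing.Theory Num.Theory.
Local Open Scope ring_scope.

(* An element of the Grassmann algebra is given by its coordinates in the basis
   of the e_S = e_{j_1} /\ ... /\ e_{j_q}, S = {j_1 < ... < j_q}, where e is the
   basis [vbasis fullv] of X; the component in Lambda^q X collects the sets of
   cardinal q. *)
Definition grassmann (K : fieldType) (X : vectType K) : Type :=
  {ffun {set 'I_(\dim {:X})} -> K^o}.

HB.instance Definition _ (K : fieldType) (X : vectType K) :=
  Vector.on (grassmann X).

Section GrassmannAlgebra.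
Variables (K : fieldType) (X : vectType K).
Local Notation n := (\dim {:X}).

Definition scalar_vector (c : K) : grassmann X :=
  [ffun S : {set 'I_n} => if S == set0 then c else 0].

Definition iota_vector (v : X) : grassmann X :=
  [ffun S : {set 'I_n} =>
     \sum_(j < n | S == [set j]) coord (vbasis fullv) j v].

Definition inversions (A B : {set 'I_n}) : nat :=
  #|[set ab : 'I_n * 'I_n | [&& ab.1 \in A, ab.2 \in B & (ab.2 < ab.1)%N]]|.

(* For disjoint A and B, e_A /\ e_B = (-1)^(inversions A B) e_(A u B); the
   product vanishes when A and B meet. *)
Definition wedge (a b : grassmann X) : grassmann X :=
  [ffun S : {set 'I_n} => \sum_(A : {set 'I_n} | A \subset S)
     (-1) ^+ inversions A (S :\: A) * (a A : K) * (b (S :\: A) : K)].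

Definition blade (s : seq X) : grassmann X :=
  foldr (fun v a => wedge (iota_vector v) a) (scalar_vector 1) s.

Definition ext_power (p : nat) (V : {vspace X}) : {vspace grassmann X} :=
  (\sum_(t : p.-tuple 'I_(\dim V)) <[blade [seq (vbasis V)`_(val j) | j <- t]]>)%VS.

Let sgn (k j : 'I_n) : K := (-1) ^+ (k < j)%N.
Let eps (j : 'I_n) (S : {set 'I_n}) : K := \prod_(k in S) sgn k j.

Lemma wedge_iotaE (v : X) (a : grassmann X) (S : {set 'I_n}) :
  wedge (iota_vector v) a S =
  \sum_(j in S) eps j S * coord (vbasis fullv) j v * (a (S :\ j) : K).
Proof.
rewrite ffunE.
under eq_bigr => A _ do rewrite ffunE mulr_sumr mulr_suml.
rewrite (exchange_big_dep xpredT) //= [LHS](bigID (mem S)) /= [X in _ + X]big1.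
  rewrite addr0; apply: eq_bigr => j jS.
  rewrite (big_pred1 [set j]) => [|A /=]; last first.
    rewrite andb_idl // => /eqP->; by rewrite sub1set.
  congr (_ * _ * _); rewrite /eps.
  rewrite (big_setD1 j jS) /= /sgn ltnn expr0 mul1r.
  rewrite -(big_morph (GRing.exp (-1 : K)) (exprD _) (expr0 _)).
  congr (_ ^+ _); rewrite /inversions.
  rewrite -sum1dep_card (eq_bigl (fun ab => (ab.1 \in [set j]) && ((ab.2 \in S :\ j) && (ab.2 < ab.1)%N))) //.
  rewrite -(pair_big_dep (fun x => x \in [set j]) (fun x k => (k \in S :\ j) && (k < x)%N) (fun _ _ => 1%N)).
  by rewrite big_set1 /= big_mkcondr; apply: eq_bigr => k _; case: ltnP.
move=> j jS; rewrite big_pred0 // => A.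
by apply/negP => /andP[/[swap] /eqP->]; rewrite sub1set (negPf jS).
Qed.

Lemma grassmannDE (c : K) (a b : grassmann X) (S : {set 'I_n}) :
  (c *: a + b) S = c * (a S : K) + b S :> K.
Proof. by rewrite ffunE ffunE. Qed.

Lemma wedge_iota_linearl (a : grassmann X) :
  linear (fun v => wedge (iota_vector v) a).
Proof.
move=> c u v; apply/ffunP => S; rewrite grassmannDE !wedge_iotaE mulr_sumr.
rewrite -big_split; apply: eq_bigr => j _ /=.
by rewrite linearP /= mulrDr mulrDl !mulrA [_ * c]mulrC.
Qed.

Lemma wedge_iota_linearr (v : X) : linear (wedge (iota_vector v)).
Proof.
move=> c a b; apply/ffunP => S; rewrite grassmannDE !wedge_iotaE mulr_sumr.
rewrite -big_split; apply: eq_bigr => j _ /=.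
by rewrite grassmannDE mulrDr !mulrA [_ * c]mulrC !mulrA.
Qed.

HB.instance Definition _ (v : X) :=
  GRing.isLinear.Build K (grassmann X) (grassmann X) *:%R (wedge (iota_vector v))
    (wedge_iota_linearr v).

Lemma blade_ext_power (V : {vspace X}) (s : seq X) :
  {subset s <= V} -> blade s \in ext_power (size s) V.
Proof.
elim: s => [_|v s IHs sV] /=.
  by rewrite memvE /ext_power (sumv_sup [tuple]).
have /memv_sumP[b bin ->] := IHs (fun x xs => sV x (mem_behead (s := v :: s) xs)).
have vV : v \in V by apply: sV; rewrite mem_head.
rewrite linear_sum; apply: memv_suml => t _ /=.
have /vlineP[c ->] := bin t isT.
rewrite linearZ memvZ //= (coord_vbasis vV).
set A := blade _.
pose L := HB.pack_for {linear X -> grassmann X} (fun v => wedge (iota_vector v) A)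
  (GRing.isLinear.Build K X (grassmann X) *:%R _ (wedge_iota_linearl A)).
rewrite -[wedge _ _]/(L _) linear_sum; apply: memv_suml => j _.
rewrite linearZ memvZ //=.
by rewrite memvE /ext_power (sumv_sup [tuple of j :: t]).
Qed.

(* Contraction by a linear form is an antiderivation of the product; it yields
   the nonvanishing of the blade of a free family. *)
Let contract (phi : X -> K) (a : grassmann X) : grassmann X :=
  [ffun T : {set 'I_n} =>
     \sum_(j in ~: T) eps j T * phi (vbasis fullv)`_j * (a (j |: T) : K)].

Let epsU1 (j k : 'I_n) (T : {set 'I_n}) :
  k \notin T -> eps j (k |: T) = sgn k j * eps j T.
Proof. by move=> kT; rewrite /eps big_setU1. Qed.

Let sgn2 (j : 'I_n) (T : {set 'I_n}) : eps j T * eps j T = 1.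
Proof.
rewrite -big_split big1 //= => k _.
by rewrite /sgn -exprD addnn -muln2 mulnC exprM sqrrN expr1n expr1n.
Qed.

Let contract_wedge (phi : {scalar X}) (v : X) (a : grassmann X) (T : {set 'I_n}) :
  contract phi (wedge (iota_vector v) a) T + wedge (iota_vector v) (contract phi a) T
  = phi v * (a T : K) :> K.
Proof.
set e := vbasis {:X}.
have -> : phi v = \sum_j coord e j v * phi e`_j.
  rewrite {1}(coord_vbasis (memvf v)) linear_sum; apply: eq_bigr => j _.
  by rewrite linearZ.
rewrite wedge_iotaE ffunE.
rewrite [in RHS](bigID (mem T)) /= mulrDl !mulr_suml addrC.
have -> : \sum_(j in T) eps j T * coord e j v * (contract phi a (T :\ j) : K) =
   \sum_(j in T) coord e j v * phi e`_j * (a T : K) + \sum_(k in T) \sum_(j in ~: T)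
     eps k T * coord e k v * (eps j (T :\ k) * phi e`_j * (a (j |: (T :\ k)) : K)).
  rewrite -big_split; apply: eq_bigr => k kT /=.
  have -> : contract phi a (T :\ k) = \sum_(j in k |: ~: T)
      eps j (T :\ k) * phi e`_j * (a (j |: (T :\ k)) : K) :> K.
    by rewrite ffunE; apply: eq_bigl => j; rewrite !inE negb_and negbK.
  rewrite big_setU1 ?inE ?kT //= mulrDr mulr_sumr; congr (_ + _).
  rewrite setD1K // -{1}(setD1K kT) epsU1 ?setD11 // /sgn ltnn expr0 mul1r.
  rewrite -[RHS]mul1r -(sgn2 k (T :\ k)); ring.
rewrite -addrA; congr (_ + _).
have -> : \sum_(j in ~: T) eps j T * phi e`_j *
     (wedge (iota_vector v) a (j |: T) : K) =
   \sum_(j < n | j \notin T) coord e j v * phi e`_j * (a T : K) +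
   \sum_(j in ~: T) \sum_(k in T)
     eps j T * phi e`_j * (eps k (j |: T) * coord e k v * (a ((j |: T) :\ k) : K)).
  rewrite [X in X + _](eq_bigl (mem (~: T))) => [|j]; last by rewrite !inE.
  rewrite -big_split; apply: eq_bigr => j; rewrite inE => jT /=.
  rewrite wedge_iotaE big_setU1 //= mulrDr mulr_sumr; congr (_ + _).
  rewrite setU1K // epsU1 // /sgn ltnn expr0 mul1r.
  rewrite -[RHS]mul1r -(sgn2 j T); ring.
rewrite addrCA -[RHS]addr0; congr (_ + _).
rewrite [X in _ + X]exchange_big -big_split big1 //= => k kT.
rewrite -big_split big1 //= => j; rewrite inE => jT.
have jk : j != k by apply: contraNneq jT => ->.
have -> : j |: (T :\ k) = (j |: T) :\ k.
  by rewrite finset.setDUl (@setDidPl _ [set j] [set k] _) // disjoints1 inE.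
rewrite epsU1 //.
have -> : eps j T = sgn k j * eps j (T :\ k).
  by rewrite -{1}(setD1K kT) epsU1 // setD11.
have -> : sgn j k = - sgn k j.
  rewrite /sgn (ltn_neqAle j) leqNgt (inj_eq val_inj) jk /=.
  by case: ltnP => _; rewrite ?expr0 ?expr1 ?opprK.
have: sgn k j * sgn k j = 1.
  by rewrite /sgn -exprD addnn -muln2 mulnC exprM sqrrN expr1n expr1n.
move=> s2; ring: s2.
Qed.

Let contract_blade (phi : {scalar X}) (s : seq X) :
  {in s, forall v, phi v = 0} -> contract phi (blade s) = 0.
Proof.
elim: s => [_|v s IHs phis] /=; apply/ffunP => T.
  rewrite !ffunE big1 // => j _; rewrite ffunE ifF ?mulr0 //.
  by apply/negP => /eqP/setP/(_ j); rewrite !inE eqxx.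
have := contract_wedge phi v (blade s) T.
rewrite phis ?mem_head // mul0r IHs => [|u us]; last first.
  by apply: phis; rewrite inE us orbT.
by rewrite linear0 !ffunE addr0.
Qed.

Lemma blade_neq0 (s : seq X) : free s -> blade s != 0.
Proof.
elim: s => [_|v s IHs fvs] /=.
  apply/eqP => /ffunP/(_ finset.set0)/eqP.
  by rewrite !ffunE eqxx oner_eq0.
have fs : free s by move: fvs; rewrite free_cons => /andP[].
apply: contraNneq (IHs fs) => w0; apply/eqP/ffunP => T.
pose B := in_tuple (v :: s); pose phi : {scalar X} := coord B ord0.
have phiE (k : 'I_(size (v :: s))) : phi B`_k = (k == ord0)%:R.
  exact: coord_free.
have phiv : phi v = 1 by apply: (phiE ord0).
have phis : {in s, forall u, phi u = 0}.
  move=> u /(nthP 0)[i ilt <-].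
  have ilt' : (i.+1 < size (v :: s))%N by [].
  exact: (phiE (Ordinal ilt')).
have := contract_wedge phi v (blade s) T.
rewrite contract_blade // w0 linear0 phiv mul1r => <-.
rewrite !ffunE big1 ?addr0 // => k _; by rewrite ffunE mulr0.
Qed.

(* The orientation is any nonzero representative of its class {c nu : c > 0}. *)
Record oriented_subspace := OrientedSubspace {
  subspace_of :> {vspace X};
  orientation : grassmann X;
  orientation_ext : orientation \in ext_power (\dim subspace_of) subspace_of;
  orientation_neq0 : orientation != 0 }.

(* Strictly increasing p-tuples of indices, numbered from 0 to m - 1. *)
Definition multi_index (p m : nat) : finType :=
  {i : p.-tuple 'I_m | sorted (relpre val ltn) i}.

Section CoordinateSubspaces.
Variables (p m : nat) (w : m.-tuple X).
Hypothesis wX : basis_of fullv w.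

Definition coord_vectors (i : multi_index p m) : seq X :=
  [seq w`_(val j) | j <- tval (val i)].

Lemma free_coord_vectors (i : multi_index p m) : free (coord_vectors i).
Proof.
have wfree := basis_free wX; have wuniq := free_uniq wfree.
pose s := [seq v <- w | v \in coord_vectors i].
suff /perm_free-> : perm_eq (coord_vectors i) s by apply: filter_free.
apply: uniq_perm => [||v]; [|by rewrite filter_uniq|].
  rewrite map_inj_in_uniq => [|j k _ _ /eqP].
    have tr : transitive (relpre (val : 'I_m -> nat) ltn).
      by move=> j k l; apply: ltn_trans.
    have ir : irreflexive (relpre (val : 'I_m -> nat) ltn).
      by move=> j; apply: ltnn.
    exact: (sorted_uniq tr ir (valP i)).
  by rewrite nth_uniq ?size_tuple ?ltn_ord // => /eqP/val_inj.
rewrite mem_filter; case vi: (v \in _) => //=; symmetry.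
by have /mapP[j _ ->] := vi; rewrite mem_nth ?size_tuple ?ltn_ord.
Qed.

Lemma dim_coord_vectors (i : multi_index p m) :
  \dim <<coord_vectors i>> = p.
Proof.
by have /eqP := free_coord_vectors i; rewrite size_map size_tuple.
Qed.

Lemma coord_blade_ext (i : multi_index p m) :
  blade (coord_vectors i) \in
    ext_power (\dim <<coord_vectors i>>) <<coord_vectors i>>.
Proof.
rewrite dim_coord_vectors -[X in ext_power X](size_tuple (val i)).
rewrite -[X in ext_power X](size_map (fun j : 'I_m => w`_(val j))).
by apply: blade_ext_power => v; apply: memv_span.
Qed.

Definition coord_subspace (i : multi_index p m) : oriented_subspace :=
  OrientedSubspace (coord_blade_ext i) (blade_neq0 (free_coord_vectors i)).

End CoordinateSubspaces.

End GrassmannAlgebra.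

(* The library's [{dot X for theta}] is linear on the left and semilinear on the
   right; the inner product <v, w>, conjugate-linear on the left, is [dot w v]. *)
Section GrassmannInnerProduct.
Variables (K : numFieldType) (theta : {rmorphism K -> K}) (X : vectType K).
Variable dot : {dot X for theta}.
Local Notation n := (\dim {:X}).

Definition inner (v w : X) : K := dot w v.

Definition gram (s t : seq X) : K :=
  if size s == size t then
    \det (\matrix_(a < size s, b < size s) inner s`_a t`_b)
  else 0.

Definition basis_vectors (S : {set 'I_n}) : seq X :=
  [seq (vbasis {:X})`_(val j) | j <- enum S].

(* The sesquilinear extension of <e_S, e_T> = gram of e_S and e_T. *)
Definition grassmann_inner (a b : grassmann X) : K :=
  \sum_(S : {set 'I_n}) \sum_(T : {set 'I_n})
    theta (a S) * (b T : K) * gram (basis_vectors S) (basis_vectors T).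

End GrassmannInnerProduct.

Variant scalar_kind := RealScalars | ComplexScalars.

Section Scalars.
Local Open Scope complex_scope.
Variable R : realType.

Definition scalars (k : scalar_kind) : numFieldType :=
  match k with RealScalars => R | ComplexScalars => R[i] end.

Definition scalar_conj (k : scalar_kind) : {rmorphism scalars k -> scalars k} :=
  match k return {rmorphism scalars k -> scalars k} with
  | RealScalars => idfun
  | ComplexScalars => Num.conj
  end.

Definition scalar_sqrt (k : scalar_kind) : scalars k -> scalars k :=
  match k return scalars k -> scalars k with
  | RealScalars => Num.sqrt
  | ComplexScalars => sqrtC
  end.

Definition complex_exp (z : R[i]) : R[i] :=
  let: x +i* y := z in (expR x * cos y) +i* (expR x * sin y).

Definition complex_cos (z : R[i]) : R[i] :=
  (complex_exp ('i * z) + complex_exp (- ('i * z))) / 2.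

Definition scalar_cos (k : scalar_kind) : scalars k -> scalars k :=
  match k return scalars k -> scalars k with
  | RealScalars => cos
  | ComplexScalars => complex_cos
  end.

Definition angle_range (k : scalar_kind) : scalars k -> Prop :=
  match k return scalars k -> Prop with
  | RealScalars => fun t => 0 <= t <= trigo.pi
  | ComplexScalars => fun=> True
  end.

Section GrassmannAngle.
Variables (k : scalar_kind) (X : vectType (scalars k)).
Variable dot : {dot X for scalar_conj k}.

Definition grassmann_norm (a : grassmann X) : scalars k :=
  scalar_sqrt (grassmann_inner dot a a).

Definition is_grassmann_angle (V W : oriented_subspace X) (t : scalars k) : Prop :=
  angle_range t /\
  scalar_cos t =
    grassmann_inner dot (orientation V) (orientation W) /
      (grassmann_norm (orientation V) * grassmann_norm (orientation W)).

(* Over R[i] the cosine determines the angle only up to sign and periods; an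
   arbitrary determination is chosen. *)
Definition grassmann_angle (V W : oriented_subspace X) : scalars k :=
  xget 0 (is_grassmann_angle V W).

End GrassmannAngle.
End Scalars.

(* Main.v *)
Require Import Defs.
From HB Require Import structures.
From mathcomp Require Import classical_sets sequences exp trigo.
From mathcomp Require Import all_boot all_order all_algebra.
From mathcomp Require Import reals sesquilinear ring.
From mathcomp.real_closed Require Import complex.

(** The coordinate p-blades b_i of an orthogonal basis of X form an orthogonal
    basis of Lambda^p X, and the formula is Parseval's identity in that basis.
    If nu and omega are the orientations of V and W, with coordinates c_i and
    d_i on the b_i, then <nu, omega> is the sum over i of
    conj(c_i) d_i <b_i, b_i>, while <nu, b_i> = conj(c_i) <b_i, b_i> and
    <b_i, omega> = d_i <b_i, b_i>. Dividing by the norms, the norm of b_i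
    appears twice in the denominators and cancels <b_i, b_i>.

    The inner product of the Grassmann algebra is defined by its values on the
    blades of one fixed basis, not an orthogonal one in general. To evaluate it
    on the b_i one needs <s_1 /\ ... /\ s_p, t_1 /\ ... /\ t_p> =
    det(<s_i, t_j>) for all vectors ([grassmann_inner_blade]). That equality
    and the fact that the b_i span ([ext_power_coord_blades]) both follow from
    one statement, [alternating_multilinear_mem]: an alternating multilinear
    map takes its values in a subspace U if it does so on the increasing lists
    of vectors of some basis. Determinants with a null row, or diagonal, give
    the orthogonality and the positivity of the b_i
    ([coord_blade_orthogonal], [coord_blade_gt0]).

    It remains to know that the angles exist, that is, that each quotient
    <nu, omega> / (|nu| |omega|) is a cosine ([cos_grassmann_angle]): over the
    reals by the Cauchy-Schwarz inequality, over the complex numbers because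
    the complex cosine is surjective ([complex_cos_surj]). *)

Set Implicit Arguments.
Unset Strict Implicit.
Unset Printing Implicit Defensive.

Import Order.TTheory GRing.Theory Num.Theory.
Local Open Scope ring_scope.

(** * Alternating multilinear maps *)

Section Alternating.
Variables (K : fieldType) (X : vectType K) (Y : vectType K).

(** Defined on lists of every length, so that one map gathers the Lambda^p for
    all p; the diagonal condition is asked of neighbours only, which is enough
    once slots can be swapped. *)
Definition alternating_multilinear (Phi : seq X -> Y) : Prop :=
  (forall s1 s2, linear (fun v => Phi (s1 ++ v :: s2))) /\
  (forall s1 v s2, Phi (s1 ++ v :: v :: s2) = 0).

Variable Phi : seq X -> Y.
Hypothesis altPhi : alternating_multilinear Phi.

(** Polarization: expand [Phi] at two equal neighbours [u + v]. *)
Lemma alternating_multilinear_swap s1 u v s2 :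
  Phi (s1 ++ u :: v :: s2) = - Phi (s1 ++ v :: u :: s2).
Proof.
have [lin alt] := altPhi; have linD x y s s' :
    Phi (s ++ (x + y) :: s') = Phi (s ++ x :: s') + Phi (s ++ y :: s').
  by have := lin s s' 1 x y; rewrite !scale1r.
have := alt s1 (u + v) s2; rewrite linD.
rewrite -!(cat_rcons _ s1 (_ :: s2)) !linD !cat_rcons !alt add0r addr0.
by move/eqP; rewrite addr_eq0 => /eqP.
Qed.

Section Basis.
Variables (n : nat) (w : n.-tuple X) (U : {vspace Y}).
Hypothesis wX : basis_of {:X} w.
Local Notation increasing := (sorted (relpre (val : 'I_n -> nat) ltn)).
Local Notation vectors l := [seq w`_(val j) | j : 'I_n <- l].

(** Insertion sort: a swap of neighbours changes the value by a sign, and an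
    index met twice gives 0, so membership in [U] needs to be tested only on
    strictly increasing lists of basis vectors. The prefix [pre] serves the
    induction: it holds the part of the list that is left untouched while its
    tail is sorted. *)
Lemma alternating_multilinear_sort (l pre : seq 'I_n) :
  (forall l', increasing l' -> size l' = size l ->
     Phi (vectors (pre ++ l')) \in U) ->
  Phi (vectors (pre ++ l)) \in U.
Proof.
have tr : transitive (relpre (val : 'I_n -> nat) ltn).
  by move=> j k m; apply: ltn_trans.
have insert x r q : increasing r ->
    (forall l', increasing l' -> size l' = (size r).+1 ->
       {subset l' <= x :: r} -> Phi (vectors (q ++ l')) \in U) ->
    Phi (vectors (q ++ x :: r)) \in U.
  elim: r q => [|y r IHr] q sr Uq; first exact: Uq.
  case: (ltngtP x y) => [xy|yx|/val_inj xy].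
  - by apply: Uq => //=; rewrite xy.
  - rewrite map_cat /= alternating_multilinear_swap rpredN.
    have -> : vectors q ++ w`_y :: w`_x :: vectors r
            = vectors (rcons q y ++ x :: r) by rewrite cat_rcons map_cat.
    have [ry sr'] : all (fun z : 'I_n => (y < z)%N) r /\ increasing r.
      by move: sr => /=; rewrite path_sortedE // => /andP[].
    apply: IHr => // l' sl' size_l' l'xr; rewrite cat_rcons; apply: Uq => /=.
    + rewrite path_sortedE // sl' andbT; apply/allP => z /l'xr.
      by rewrite inE => /predU1P[->|/(allP ry)].
    + by rewrite size_l'.
    + move=> z; rewrite inE => /predU1P[->|/l'xr]; rewrite !inE ?eqxx ?orbT //.
      by case/orP=> ->; rewrite ?orbT.
  - by rewrite xy map_cat /= (proj2 altPhi) mem0v.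
elim: l pre => [|x l IHl] pre Upre; first exact: Upre.
rewrite -cat_rcons; apply: IHl => l' sl' size_l'; rewrite cat_rcons.
apply: insert => // l'' sl'' size_l'' _.
by apply: Upre; rewrite // size_l'' size_l'.
Qed.

(** Expanding every slot in the basis reduces to lists of basis vectors, which
    are then sorted. With [U] spanned by the increasing blades this says that
    they span the exterior power; with [U] null, that an alternating
    multilinear map is determined by its values on increasing lists. *)
Lemma alternating_multilinear_mem (p : nat) :
  (forall l, increasing l -> size l = p -> Phi (vectors l) \in U) ->
  forall s, size s = p -> Phi s \in U.
Proof.
move=> Uinc s size_s.
suff mem_mixed l t : (size l + size t)%N = p -> Phi (vectors l ++ t) \in U.
  exact: (mem_mixed [::] s size_s).
elim: t l => [|v t IHt] l size_lt.
  rewrite cats0.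
  apply: (@alternating_multilinear_sort l [::]) => l' sl' size_l'.
  by apply: Uinc; rewrite // size_l' -size_lt addn0.
pose L := HB.pack_for {linear X -> Y} (fun v => Phi (vectors l ++ v :: t))
  (GRing.isLinear.Build K X Y *:%R _ (proj1 altPhi (vectors l) t)).
rewrite -[Phi _]/(L v) (coord_basis wX (memvf v)) linear_sum.
apply: memv_suml => j _; rewrite linearZ memvZ //=.
have -> : vectors l ++ w`_j :: t = vectors (rcons l j) ++ t.
  by rewrite map_rcons cat_rcons.
by apply: IHt; rewrite size_rcons addSnnS.
Qed.

End Basis.
End Alternating.

(** * The blade of a list of vectors *)

Section Blades.
Variables (K : numFieldType) (X : vectType K).
Local Notation n := (\dim {:X}).
Local Notation increasing := (sorted (relpre (val : 'I_n -> nat) ltn)).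

Lemma wedge_iota0 (v : X) : wedge (iota_vector v) 0 = 0.
Proof.
by have := wedge_iota_linearr v (-1) 0 0; rewrite !scaleN1r oppr0 addr0 addNr.
Qed.

(** In the double sum of the coefficient on [S], the terms of indices (j, k)
    and (k, j) are opposite, because exactly one of j < k and k < j holds. *)
Lemma wedge_iota_alternate (v : X) (a : grassmann X) :
  wedge (iota_vector v) (wedge (iota_vector v) a) = 0.
Proof.
apply/ffunP => S; rewrite [RHS]ffunE.
pose c j := coord (vbasis {:X}) j v.
pose sgn (k j : 'I_n) : K := (-1) ^+ (k < j)%N.
pose eps j (T : {set 'I_n}) := \prod_(k in T) sgn k j.
pose F j k := eps j S * c j * (eps k (S :\ j) * c k * (a (S :\ j :\ k) : K)).
rewrite (_ : wedge _ _ S = \sum_(j in S) \sum_(k in S :\ j) F j k); last first.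
  rewrite wedge_iotaE; apply: eq_bigr => j _; rewrite wedge_iotaE mulr_sumr.
  by apply: eq_bigr.
have antisym j k : j \in S -> k \in S :\ j -> F k j = - F j k.
  move=> jS kSj; have /setD1P[kj kS] := kSj.
  have epsD i l : l \in S -> eps i S = sgn l i * eps i (S :\ l).
    by move=> lS; rewrite /eps (big_setD1 l lS).
  have -> : F k j = sgn j k * (eps k (S :\ j) * c k *
      (eps j (S :\ k) * c j * (a (S :\ j :\ k) : K))).
    by rewrite /F (epsD k j jS) !setDDl [_ |: _]setUC !mulrA.
  rewrite /F (epsD j k kS).
  have -> : sgn j k = - sgn k j.
    by rewrite /sgn; case: ltngtP kj => [||/val_inj->];
      rewrite ?eqxx // ?expr0 ?expr1 ?opprK.
  ring.
(* Exchanging the two sums turns the total into its opposite. *)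
set x := \sum_(j in S) _; suff : - x == x by rewrite eqNr => /eqP.
apply/eqP; rewrite {2}/x (exchange_big_dep (mem S)) /=; last first.
  by move=> j k _ /setD1P[].
rewrite -sumrN; apply: eq_bigr => j jS; rewrite -sumrN.
rewrite [RHS](eq_bigl (mem (S :\ j))) => [|k]; last first.
  by rewrite /= !inE jS andbT eq_sym andbC.
by apply: eq_bigr => k kSj; rewrite (antisym j k).
Qed.

Lemma blade_alternating :
  alternating_multilinear (Y := grassmann X) (@blade K X).
Proof.
split=> [s1 s2 c u v|s1 v s2]; elim: s1 => [|x s1 IHs] /=.
- exact: wedge_iota_linearl.
- by rewrite IHs wedge_iota_linearr.
- exact: wedge_iota_alternate.
- by rewrite IHs wedge_iota0.
Qed.

(** The signs in the successive products are all 1, since each factor stands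
    before the indices already collected. *)
Lemma blade_increasing (l : seq 'I_n) (S : {set 'I_n}) : increasing l ->
  blade [seq (vbasis {:X})`_(val j) | j <- l] S = (S == [set x in l])%:R.
Proof.
have tr : transitive (relpre (val : 'I_n -> nat) ltn).
  by move=> j k m; apply: ltn_trans.
elim: l S => [|x l IHl] S /=.
  by move=> _; rewrite ffunE set_nil; case: eqP.
rewrite path_sortedE // => /andP[/allP xl sl].
have x'l : x \notin [set y in l].
  by rewrite inE; apply/negP => /xl /=; rewrite ltnn.
have cX j : coord (vbasis {:X}) j (vbasis {:X})`_(val x) = (x == j)%:R.
  by rewrite coord_free ?(basis_free (vbasisP _)).
rewrite wedge_iotaE; case: (boolP (x \in S)) => [xS|x'S]; last first.
  rewrite big1 => [|j jS]; last first.
    by rewrite cX; case: eqP jS x'S => [->->//|]; rewrite mulr0 mul0r.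
  by case: eqP => // eqS; move: x'S; rewrite eqS inE mem_head.
rewrite (big_setD1 x xS) /= [X in _ + X]big1 => [|j]; last first.
  by rewrite !inE cX eq_sym => /andP[/negPf-> _]; rewrite mulr0 mul0r.
rewrite cX eqxx mulr1 addr0 IHl //.
have -> : (S :\ x == [set y in l]) = (S == [set y in x :: l]).
  rewrite set_cons; apply/eqP/eqP => [<-|->]; first by rewrite setD1K.
  by rewrite setU1K.
case: eqP => [->|]; last by rewrite mulr0.
rewrite mulr1 big1 // => k; rewrite !inE => /predU1P[->|/xl /=].
  by rewrite ltnn.
by move=> xk; rewrite ltnNge ltnW.
Qed.

Lemma enum_increasing (S : {set 'I_n}) : increasing (enum S).
Proof.
apply: sorted_filter; first by move=> j k m; apply: ltn_trans.
by rewrite -enumT -sorted_map val_enum_ord iota_ltn_sorted.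
Qed.

Lemma blade_basis_vectors (S T : {set 'I_n}) :
  blade (basis_vectors S) T = (T == S)%:R.
Proof. by rewrite blade_increasing ?enum_increasing // set_enum. Qed.

Lemma increasing_enum (l : seq 'I_n) : increasing l -> l = enum [set x in l].
Proof.
move=> sl; apply: irr_sorted_eq (sl) (enum_increasing _) _.
- by move=> j k m; apply: ltn_trans.
- by move=> j; apply: ltnn.
- by move=> j; rewrite mem_enum inE.
Qed.

End Blades.

(** * The inner product of two blades *)

Section Gram.
Variables (K : numFieldType) (theta : {rmorphism K -> K}) (X : vectType K).
Variable dot : {dot X for theta}.
Local Notation n := (\dim {:X}).

Lemma dotC u v : dot u v = theta (dot v u).
Proof. by apply: etrans (hermC dot u v) _; rewrite expr0 mul1r. Qed.

(** The matrix gets the size [p], so that the matrices of lists of equal, but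
    not convertible, lengths can be compared. *)
Lemma gramE p s t : size s = p -> size t = p ->
  gram dot s t = \det (\matrix_(a < p, b < p) inner dot s`_a t`_b).
Proof. by move=> <- eq_st; rewrite /gram eq_st eqxx. Qed.

Lemma gramE_tr p s t : size s = p -> size t = p ->
  gram dot s t = \det (\matrix_(b < p, a < p) inner dot s`_a t`_b).
Proof.
move=> ps pt; rewrite (gramE ps pt) -det_tr; congr (\det _).
by apply/matrixP => a b; rewrite !mxE.
Qed.

Lemma gram_hermitian s t : gram dot t s = theta (gram dot s t).
Proof.
have [eq_st|neq_st] := eqVneq (size s) (size t); last first.
  by rewrite /gram eq_sym (negPf neq_st) rmorph0.
rewrite (gramE_tr eq_st erefl) (gramE erefl eq_st) -det_map_mx.
congr (\det _); apply/matrixP => a b; rewrite !mxE /inner.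
exact: dotC.
Qed.

Lemma gram_alternating s : alternating_multilinear (gram dot s : seq X -> K^o).
Proof.
split=> [s1 s2 c u v|s1 v s2] /=.
  have szE x : size (s1 ++ x :: s2) = (size s1 + size s2).+1.
    by rewrite size_cat /= addnS.
  case: (eqVneq (size s) (size s1 + size s2).+1) => [szs|neq]; last first.
    by rewrite /gram !szE (negPf neq) scaler0 addr0.
  rewrite !(gramE_tr szs (szE _)).
  have ltp : (size s1 < (size s1 + size s2).+1)%N by rewrite ltnS leq_addr.
  rewrite -[X in _ = _ + X]mul1r.
  apply: (determinant_multilinear (i0 := Ordinal ltp)).
  - apply/rowP => a; rewrite !mxE /= !nth_cat ltnn subnn /= /inner.
    by rewrite linearPl mul1r.
  (* Off the row of index [size s1], both lists have the same entries. *)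
  - apply/matrixP => a b; rewrite !mxE !nth_cat; set k := lift _ _.
    have := neq_lift (Ordinal ltp) a; rewrite -val_eqE /= -/k => ne.
    case: ltngtP ne => // lt _; by rewrite -(subnSK lt).
  - apply/matrixP => a b; rewrite !mxE !nth_cat; set k := lift _ _.
    have := neq_lift (Ordinal ltp) a; rewrite -val_eqE /= -/k => ne.
    case: ltngtP ne => // lt _; by rewrite -(subnSK lt).
have szE : size (s1 ++ v :: v :: s2) = (size s1 + size s2).+2.
  by rewrite size_cat /= !addnS.
case: (eqVneq (size s) (size s1 + size s2).+2) => [szs|neq]; last first.
  by rewrite /gram szE (negPf neq).
rewrite (gramE_tr szs szE).
have lt1 : (size s1 < (size s1 + size s2).+2)%N by rewrite ltnS leqW ?leq_addr.
have lt2 : ((size s1).+1 < (size s1 + size s2).+2)%N by rewrite !ltnS leq_addr.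
apply: (determinant_alternate (i1 := Ordinal lt1) (i2 := Ordinal lt2)).
  by rewrite -val_eqE /= neq_ltn ltnSn.
by move=> a; rewrite !mxE /= !nth_cat ltnn ltnNge leqnSn /= subnn subSnn.
Qed.

Hypothesis thetaK : involutive theta.

Lemma grassmann_inner_hermitian a b :
  grassmann_inner dot b a = theta (grassmann_inner dot a b).
Proof.
rewrite /grassmann_inner rmorph_sum exchange_big; apply: eq_bigr => S _.
rewrite rmorph_sum; apply: eq_bigr => T _ /=.
by rewrite (gram_hermitian (basis_vectors S)) !rmorphM thetaK /=
  [theta _ * _]mulrC.
Qed.

Lemma grassmann_inner_linear a :
  linear (grassmann_inner dot a : grassmann X -> K^o).
Proof.
move=> c u v; rewrite /grassmann_inner scaler_sumr -big_split.
apply: eq_bigr => S _; rewrite /= scaler_sumr -big_split.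
apply: eq_bigr => T _; rewrite /= grassmannDE /GRing.scale /=; ring.
Qed.

Lemma grassmann_inner_sumr (I : finType) (c : I -> K) (v : I -> grassmann X) a :
  grassmann_inner dot a (\sum_i c i *: v i)
  = \sum_i c i * grassmann_inner dot a (v i).
Proof.
pose L := HB.pack_for {scalar (grassmann X)} (grassmann_inner dot a)
  (GRing.isLinear.Build K (grassmann X) K _ _ (grassmann_inner_linear a)).
by rewrite -[LHS]/(L _) linear_sum; apply: eq_bigr => i _; rewrite linearZ.
Qed.

Lemma grassmann_inner_basis S T :
  grassmann_inner dot (blade (basis_vectors S)) (blade (basis_vectors T))
  = gram dot (basis_vectors S) (basis_vectors T).
Proof.
rewrite /grassmann_inner (bigD1 S) //= (bigD1 T) //= !blade_basis_vectors.
rewrite !eqxx rmorph1 !mul1r big1 => [|T' /negPf neqT]; last first.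
  by rewrite blade_basis_vectors neqT mulr0 mul0r.
rewrite big1 => [|S' /negPf neqS]; first by rewrite !addr0.
by rewrite big1 // => T' _; rewrite blade_basis_vectors neqS rmorph0 !mul0r.
Qed.


(** Both sides are alternating multilinear in [t], hence equal as soon as they
    agree on the increasing lists [basis_vectors T]. Hermitian symmetry then
    exchanges the two arguments, and the same reduction applies to [s]; on two
    lists of basis vectors the equality is the definition of the left side. *)
Lemma grassmann_inner_blade s t : size s = size t ->
  grassmann_inner dot (blade s) (blade t) = gram dot s t.
Proof.
pose D s t : K^o := grassmann_inner dot (blade s) (blade t) - gram dot s t.
have altD s' : alternating_multilinear (D s').
  have [linB altB] := blade_alternating X.
  have [linG altG] := gram_alternating s'.
  split=> [t1 t2 c u v|t1 v t2]; rewrite /D.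
    rewrite linB grassmann_inner_linear linG scalerBr opprD /=.
    by rewrite -!addrA; congr (_ + _); rewrite addrCA.
  rewrite altB altG subr0.
  have := grassmann_inner_linear (blade s') (-1) 0 0.
  by rewrite !scaleN1r oppr0 addr0 addNr.
have reduce s' t' :
    (forall T : {set 'I_n}, #|T| = size t' -> D s' (basis_vectors T) = 0) ->
    D s' t' = 0.
  move=> D0; apply/eqP; rewrite -memv0.
  apply: (alternating_multilinear_mem (altD s') (vbasisP fullv) _ erefl).
  move=> l sl size_l; rewrite memv0.
  rewrite (increasing_enum sl) -/(basis_vectors _) D0 //.
  by rewrite cardE -increasing_enum.
move=> size_st; apply/eqP; rewrite -subr_eq0; apply/eqP.
apply: (reduce s t) => T sizeT.
rewrite /D (grassmann_inner_hermitian (blade (basis_vectors T))).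
rewrite (gram_hermitian (basis_vectors T)) -rmorphB -[X in theta X]/(D _ _).
rewrite reduce ?rmorph0 // => S sizeS.
by rewrite /D grassmann_inner_basis subrr.
Qed.

End Gram.

(** * Coordinate blades of an orthogonal basis *)

Section CoordinateBlades.
Variables (K : numFieldType) (theta : {rmorphism K -> K}) (X : vectType K).
Variable dot : {dot X for theta}.
Hypothesis thetaK : involutive theta.
Variables (p m : nat) (w : m.-tuple X).
Hypotheses (wX : basis_of {:X} w) (w_ortho : pairwise_orthogonal dot w).
Local Notation b := (fun i : multi_index p m => blade (coord_vectors w i)).

Lemma nth_basis_orthogonal (j k : 'I_m) :
  j != k -> dot w`_j w`_k = 0.
Proof.
have [_ orthow] := andP w_ortho.
have lt_ortho (s : seq X) a c : pair_ortho_rec dot s -> (a < c < size s)%N ->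
    dot s`_a s`_c = 0.
  elim: s a c => [|v s IHs] [|a] [|c] //=; rewrite ?ltn0 ?andbF // ltnS.
    by case/andP=> /andP[/allP vs _] _ /= ltc; apply/eqP/vs/mem_nth.
  by case/andP=> _; apply: IHs.
have lt_tuple (a c : 'I_m) : (a < c)%N -> dot w`_a w`_c = 0.
  by move=> ac; apply: (lt_ortho _ _ _ orthow); rewrite ac size_tuple ltn_ord.
rewrite neq_ltn => /orP[|kj]; first exact: lt_tuple.
by rewrite (dotC dot) lt_tuple ?rmorph0.
Qed.

Lemma size_coord_vectors (i : multi_index p m) : size (coord_vectors w i) = p.
Proof. by rewrite size_map size_tuple. Qed.

Lemma nth_coord_vectors (i : multi_index p m) (a : 'I_p) :
  (coord_vectors w i)`_a = w`_(tnth (val i) a).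
Proof.
by rewrite (nth_map (tnth (val i) a)) ?size_tuple // -tnth_nth.
Qed.

Lemma multi_index_uniq (i : multi_index p m) : uniq (val i).
Proof.
apply: (sorted_uniq _ _ (valP i)); first by move=> j k l; apply: ltn_trans.
by move=> j; apply: ltnn.
Qed.

Lemma multi_index_subset_eq (i j : multi_index p m) :
  {subset val i <= val j} -> i = j.
Proof.
move=> sub_ij; apply/val_inj/val_inj.
have := uniq_min_size (multi_index_uniq i) sub_ij.
rewrite !size_tuple => /(_ (leqnn _))[_ eq_ij].
apply: irr_sorted_eq (valP i) (valP j) eq_ij; last by move=> k; apply: ltnn.
by move=> k l q; apply: ltn_trans.
Qed.

(** Some vector of the list [i] is missing from the list [j], and it gives a
    null row in the Gram matrix. *)
Lemma coord_blade_orthogonal (i j : multi_index p m) : i != j ->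
  grassmann_inner dot (b i) (b j) = 0.
Proof.
move=> neq_ij; rewrite grassmann_inner_blade ?size_coord_vectors //.
have [a a'j] : exists a, tnth (val i) a \notin val j.
  apply/existsP; apply: contraNT neq_ij; rewrite negb_exists => /forallP ij.
  apply/eqP/multi_index_subset_eq => k /tnthP[a ->]; by have := ij a; rewrite negbK.
rewrite (gramE _ (size_coord_vectors i) (size_coord_vectors j)).
rewrite (expand_det_row _ a) big1 // => c _; rewrite mxE /inner.
rewrite !nth_coord_vectors nth_basis_orthogonal ?mul0r //.
by apply: contraNneq a'j => <-; rewrite mem_tnth.
Qed.

(** The Gram matrix is diagonal, with the squared norms of basis vectors. *)
Lemma coord_blade_gt0 (i : multi_index p m) :
  0 < grassmann_inner dot (b i) (b i).
Proof.
rewrite grassmann_inner_blade //.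
rewrite (gramE _ (size_coord_vectors i) (size_coord_vectors i)).
set A := matrix_of_fun _ _; pose d := \row_(a < p) A a a.
have -> : A = diag_mx d.
  apply/matrixP => a c; rewrite !mxE; case: eqVneq => [->|ne_ac] //.
  rewrite mulr0n /inner !nth_coord_vectors nth_basis_orthogonal //.
  by rewrite (inj_eq (tuple_uniqP _ (multi_index_uniq i))) eq_sym.
rewrite det_diag prodr_gt0 // => a _; rewrite !mxE /inner nth_coord_vectors.
apply: neq0_dnorm_gt0; have [w'0 _] := andP w_ortho.
by apply: contraNneq w'0 => <-; rewrite mem_nth // size_tuple.
Qed.

Lemma ext_power_coord_blades (V : {vspace X}) (nu : grassmann X) :
  nu \in ext_power p V ->
  exists c : multi_index p m -> K, nu = \sum_i c i *: b i.
Proof.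
have bladeU s : size s = p -> blade s \in (\sum_i <[b i]>)%VS.
  apply: (alternating_multilinear_mem (blade_alternating X) wX).
  move=> l sl /eqP size_l.
  (* A strictly increasing list of length [p] is a multi-index. *)
  pose i : multi_index p m := exist _ (Tuple size_l) sl.
  have -> : blade [seq w`_(val j) | j <- l] = b i by [].
  by rewrite memvE (sumv_sup i).
case/memv_sumP=> v_ vin ->.
have /memv_sumP[u_ uin eqnu] : \sum_t v_ t \in (\sum_i <[b i]>)%VS.
  apply: memv_suml => t _; have /vlineP[c ->] := vin t isT.
  by rewrite memvZ // bladeU // size_map size_tuple.
have c_ i : exists c, u_ i == c *: b i.
  by have /vlineP[c ->] := uin i isT; exists c.
exists (fun i => xchoose (c_ i)); rewrite eqnu; apply: eq_bigr => i _.
by rewrite -(eqP (xchooseP (c_ i))).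
Qed.

Lemma grassmann_inner_coord_blade (c : multi_index p m -> K) i :
  grassmann_inner dot (b i) (\sum_j c j *: b j)
  = c i * grassmann_inner dot (b i) (b i).
Proof.
rewrite grassmann_inner_sumr (bigD1 i) //= big1 ?addr0 // => j ne_ji.
by rewrite coord_blade_orthogonal ?mulr0 // eq_sym.
Qed.

Lemma grassmann_inner_sum (c d : multi_index p m -> K) :
  grassmann_inner dot (\sum_i c i *: b i) (\sum_j d j *: b j)
  = \sum_i theta (c i) * d i * grassmann_inner dot (b i) (b i).
Proof.
rewrite grassmann_inner_sumr; apply: eq_bigr => i _.
rewrite (grassmann_inner_hermitian _ thetaK (b i)) grassmann_inner_coord_blade.
rewrite rmorphM -(grassmann_inner_hermitian _ thetaK) /=.
by rewrite mulrA [d i * _]mulrC.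
Qed.

End CoordinateBlades.

(** * Angles determined by their cosine *)

(** Lagrange's identity: twice the difference of the two sides is the sum over
    i and j of the nonnegative terms
    [g i * g j * (theta (D i j) * D i j)], with [D i j] the 2 x 2 minors of [c]
    and [d]. *)
Lemma cauchy_schwarz_sum (K : numFieldType) (theta : {rmorphism K -> K})
    (thetaK : involutive theta) (theta_ge0 : forall x, 0 <= theta x * x)
    (I : finType) (g c d : I -> K) :
  (forall i, 0 <= g i) -> (forall i, theta (g i) = g i) ->
  theta (\sum_i theta (c i) * d i * g i) * (\sum_i theta (c i) * d i * g i) <=
  (\sum_i theta (c i) * c i * g i) * (\sum_i theta (d i) * d i * g i).
Proof.
move=> g_ge0 theta_g; set C := \sum_i _; set A := \sum_i _; set B := \sum_i _.
pose D i j := c i * d j - c j * d i.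
have : 0 <= \sum_i \sum_j g i * g j * (theta (D i j) * D i j).
  apply: sumr_ge0 => i _; apply: sumr_ge0 => j _.
  by rewrite mulr_ge0 ?theta_ge0 ?mulr_ge0 ?g_ge0.
have thetaC : theta C = \sum_i theta (d i) * c i * g i.
  rewrite rmorph_sum; apply: eq_bigr => i _.
  by rewrite !rmorphM thetaK theta_g [theta (d i) * _]mulrC.
have mul_sum (F G : I -> K) :
    (\sum_i F i) * (\sum_j G j) = \sum_i \sum_j F i * G j.
  by rewrite mulr_suml; apply: eq_bigr => i _; rewrite mulr_sumr.
suff -> : \sum_i \sum_j g i * g j * (theta (D i j) * D i j)
        = (A * B - theta C * C) *+ 2 by rewrite pmulrn_lge0 // subr_ge0.
have -> : (A * B - theta C * C) *+ 2
        = A * B + B * A - C * theta C - theta C * C.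
  ring.
rewrite thetaC !mul_sum -big_split -!sumrB; apply: eq_bigr => i _.
rewrite -big_split -!sumrB; apply: eq_bigr => j _ /=.
rewrite /D rmorphB !rmorphM /=; ring.
Qed.

Section Scalars.
Variable R : realType.
Local Open Scope complex_scope.

Lemma scalar_conjK k : involutive (scalar_conj R k).
Proof. by case: k => [x|x] //=; apply: conjCK. Qed.

Lemma scalar_conj_ge0 k x : 0 <= scalar_conj R k x * x.
Proof.
case: k x => x /=; first by rewrite -expr2 sqr_ge0.
by rewrite mulrC mul_conjC_ge0.
Qed.

Lemma sqr_scalar_sqrt k (x : scalars R k) : 0 <= x -> scalar_sqrt x ^+ 2 = x.
Proof. by case: k x => x /= x_ge0; [apply: sqr_sqrtr | apply: sqrtCK]. Qed.

Lemma scalar_conj_sqrt k (x : scalars R k) : 0 <= x ->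
  scalar_conj R k (scalar_sqrt x) = scalar_sqrt x.
Proof. by case: k x => x //= x_ge0; rewrite geC0_conj ?sqrtC_ge0. Qed.

(** Polar coordinates: [acos] gives the argument up to its sign, which is that
    of the imaginary part. *)
Lemma complex_exp_surj (u : R[i]) : u != 0 -> exists z, complex_exp z = u.
Proof.
case: u => a b u_neq0; pose r := Num.sqrt (a ^+ 2 + b ^+ 2).
have s_gt0 : 0 < a ^+ 2 + b ^+ 2.
  rewrite lt_def addr_ge0 ?sqr_ge0 // andbT paddr_eq0 ?sqr_ge0 // !sqrf_eq0.
  by apply: contraNN u_neq0 => /andP[/eqP-> /eqP->].
have r_gt0 : 0 < r by rewrite sqrtr_gt0.
have r2 : r ^+ 2 = a ^+ 2 + b ^+ 2 by rewrite sqr_sqrtr // ltW.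
have cs : (a / r) ^+ 2 + (b / r) ^+ 2 = 1.
  by rewrite !expr_div_n -mulrDl -r2 divff // expf_neq0 // gt_eqF.
have c_le1 : -1 <= a / r <= 1.
  rewrite -ler_norml -(@expr_le1 _ 2) // real_normK ?num_real //.
  by rewrite -cs lerDl sqr_ge0.
have cosE : cos (acos (a / r)) = a / r by rewrite acosK // in_itv.
have sinE : sin (acos (a / r)) = `|b / r|.
  by rewrite sin_acos // -cs [X in X - _]addrC addrK sqrtr_sqr.
exists (ln r +i* (if 0 <= b then acos (a / r) else - acos (a / r))).
rewrite /= lnK ?posrE //; case: ifP => b_ge0.
  rewrite cosE sinE ger0_norm ?divr_ge0 ?(ltW r_gt0) //.
  by rewrite mulrC divfK ?gt_eqF // mulrC divfK ?gt_eqF.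
have b_lt0 : b < 0 by rewrite ltNge b_ge0.
rewrite cosN sinN cosE sinE ltr0_norm ?pmulr_llt0 ?invr_gt0 // opprK.
by rewrite mulrC divfK ?gt_eqF // mulrC divfK ?gt_eqF.
Qed.

Lemma complex_expN (z : R[i]) : complex_exp (- z) = (complex_exp z)^-1.
Proof.
suff expMN : complex_exp z * complex_exp (- z) = 1.
  have ez : complex_exp z != 0.
    by apply: contra_eq_neq expMN => ->; rewrite mul0r eq_sym oner_eq0.
  by apply: (mulfI ez); rewrite expMN divff.
case: z => x y /=; rewrite expRN cosN sinN.
have e_neq0 : expR x != 0 by rewrite gt_eqF ?expR_gt0.
apply/eqP; rewrite eq_complex /=; apply/andP; split; apply/eqP.
  by rewrite -(cos2Dsin2 y); field.
by field.
Qed.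

(** Writing u for the exponential of i t, the equation cos t = c says that
    u + u^-1 = 2 c: u is either root c + s or c - s of u^2 - 2 c u + 1. *)
Lemma complex_cos_surj (c : R[i]) : exists t, complex_cos t = c.
Proof.
pose s := sqrtC (c ^+ 2 - 1).
have s2 : s ^+ 2 = c ^+ 2 - 1 by apply: sqrtCK.
have inv_u : (c + s) * (c - s) = 1 by rewrite mulrC -subr_sqr s2; ring.
have u_neq0 : c + s != 0.
  by apply: contra_eq_neq inv_u => ->; rewrite mul0r eq_sym oner_eq0.
have [z expz] := complex_exp_surj u_neq0.
exists (- 'i * z); rewrite /complex_cos.
have -> : 'i * (- 'i * z) = z.
  by rewrite mulrA mulrN -expr2 sqr_i opprK mul1r.
have invE : (c + s)^-1 = c - s by apply: (mulfI u_neq0); rewrite inv_u divff.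
rewrite complex_expN expz invE.
by field.
Qed.

(** Over the reals the bound says that x lies in [-1, 1]; in this form it is
    what [cauchy_schwarz_sum] provides over both fields. *)
Lemma scalar_cos_surj k (x : scalars R k) :
  scalar_conj R k x * x <= 1 -> exists t, angle_range t /\ scalar_cos t = x.
Proof.
case: k x => x /= x_le1; last by have [t <-] := complex_cos_surj x; exists t.
have x_bound : -1 <= x <= 1.
  by rewrite -ler_norml -(@expr_le1 _ 2) // real_normK ?num_real // expr2.
by exists (acos x); rewrite acos_ge0 // acos_lepi // acosK // in_itv.
Qed.

End Scalars.

(** * The cosine formula *)

Section CosGrassmannAngle.
Variables (R : realType) (k : scalar_kind) (X : vectType (scalars R k)).
Variable dot : {dot X for scalar_conj R k}.
Variables (n p : nat) (w : n.-tuple X).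
Hypotheses (wX : basis_of {:X} w) (w_ortho : pairwise_orthogonal dot w).
Local Notation conj := (scalar_conj R k).
Local Notation b := (fun i : multi_index p n => blade (coord_vectors w i)).

(** [grassmann_angle] is a choice among the numbers with the prescribed cosine;
    the content is that the choice is not void. Over the reals this is the
    Cauchy-Schwarz inequality, read in the coordinates of the two orientations
    on the coordinate blades. *)
Lemma cos_grassmann_angle (V W : oriented_subspace X) :
  \dim V = p -> \dim W = p ->
  scalar_cos (grassmann_angle dot V W) =
  grassmann_inner dot (orientation V) (orientation W) /
    (grassmann_norm dot (orientation V) * grassmann_norm dot (orientation W)).
Proof.
move=> dimV dimW; set x := _ / _.
suff [t angle_t] : exists t, angle_range t /\ scalar_cos t = x.
  by have [] := xgetI 0 (P := is_grassmann_angle dot V W) angle_t.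
apply: scalar_cos_surj.
have := orientation_ext V; rewrite dimV.
case/(ext_power_coord_blades wX) => c eqV.
have := orientation_ext W; rewrite dimW.
case/(ext_power_coord_blades wX) => d eqW.
have theta_g i : conj (grassmann_inner dot (b i) (b i))
               = grassmann_inner dot (b i) (b i).
  by rewrite -(grassmann_inner_hermitian _ (@scalar_conjK R k)).
have g_ge0 (i : multi_index p n) :=
  ltW (coord_blade_gt0 (@scalar_conjK R k) w_ortho i).
have norm_ge0 a :
    0 <= grassmann_inner dot (\sum_i a i *: b i) (\sum_i a i *: b i).
  rewrite (grassmann_inner_sum (@scalar_conjK R k) w_ortho).
  by apply: sumr_ge0 => i _; rewrite mulr_ge0 ?scalar_conj_ge0.
have := cauchy_schwarz_sum (@scalar_conjK R k) (@scalar_conj_ge0 R k)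
  c d g_ge0 theta_g.
rewrite -!(grassmann_inner_sum (@scalar_conjK R k) w_ortho) -eqV -eqW /=.
move: (norm_ge0 c) (norm_ge0 d).
rewrite -eqV -eqW /x /grassmann_norm.
set A := grassmann_inner dot _ _; set B := grassmann_inner dot _ _.
set C := grassmann_inner dot _ _ => A_ge0 B_ge0 CS.
rewrite fmorph_div rmorphM !scalar_conj_sqrt // mulrACA -invfM.
rewrite mulrACA -!expr2 !sqr_scalar_sqrt //.
have [AB0|AB_neq0] := eqVneq (A * B) 0; first by rewrite AB0 invr0 mulr0.
by rewrite ler_pdivrMr ?mul1r // lt_def AB_neq0 mulr_ge0.
Qed.

End CosGrassmannAngle.

Theorem theorem8p1 (R : realType) (k : scalar_kind)
    (X : vectType (scalars R k)) (dot : {dot X for scalar_conj R k})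
    (n p : nat) (dimX : \dim {:X} = n)
    (w : n.-tuple X) (wX : basis_of {:X} w) (w_ortho : pairwise_orthogonal dot w)
    (V W : oriented_subspace X) (dimV : \dim V = p) (dimW : \dim W = p) :
  scalar_cos (grassmann_angle dot V W) =
  \sum_(i : multi_index p n)
     scalar_cos (grassmann_angle dot V (coord_subspace wX i)) *
     scalar_cos (grassmann_angle dot (coord_subspace wX i) W).
Proof.
have thetaK := @scalar_conjK R k.
rewrite (cos_grassmann_angle wX w_ortho dimV dimW).
under eq_bigr => i _.
  have dim_i : \dim (coord_subspace wX i) = p := dim_coord_vectors wX i.
  rewrite (cos_grassmann_angle wX w_ortho dimV dim_i).
  rewrite (cos_grassmann_angle wX w_ortho dim_i dimW) /=.
  over.
have := orientation_ext V; rewrite dimV.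
case/(ext_power_coord_blades wX) => c ->.
have := orientation_ext W; rewrite dimW.
case/(ext_power_coord_blades wX) => d ->.
rewrite (grassmann_inner_sum thetaK w_ortho) mulr_suml; apply: eq_bigr => i _.
set nu := \sum_j c j *: _; set omega := \sum_j d j *: _.
set e := blade (coord_vectors w i); set G := grassmann_inner dot e e.
have -> : grassmann_inner dot nu e = scalar_conj R k (c i) * G.
  rewrite (grassmann_inner_hermitian dot thetaK e).
  rewrite grassmann_inner_coord_blade //.
  by rewrite rmorphM -(grassmann_inner_hermitian dot thetaK).
rewrite grassmann_inner_coord_blade // -/e -/G.
have G_gt0 : 0 < G := coord_blade_gt0 thetaK w_ortho i.
have normE : G = grassmann_norm dot e * grassmann_norm dot e.
  by rewrite -expr2 sqr_scalar_sqrt ?ltW.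
have norm_neq0 : grassmann_norm dot e != 0.
  by apply: contraTneq G_gt0; rewrite normE => ->; rewrite mul0r ltxx.
have norm_divK : grassmann_norm dot e * (grassmann_norm dot e)^-1 = 1.
  exact: divff.
rewrite normE !invfM; ring: norm_divK.
Qed.
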